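(* Let $\phi$ be a partial flow on a metric space $X$. Every isolated set $\Lambda$ of $\phi$ admits a catenary function.
   Context: A partial flow on a metric space $X$ is a continuous map $\phi\colon\Gamma\to X$ on an open set $\Gamma\subset\mathbb{R}\times X$. Here $\Gamma_x=\{t:(t,x)\in\Gamma\}$ is a connected set containing $0$, $\Gamma_{\phi_t(x)}=\Gamma_x-t$, $\phi_0=\mathrm{id}$, and $\phi_s\phi_t=\phi_{s+t}$ where defined. A $\phi$-invariant set $\Lambda$ is isolated if there is a compact neighborhood $N$ (an isolating neighborhood) such that $\phi_{\Gamma_x}(x)\subseteq N$ implies $x\in\Lambda$. $\dot{\mathcal L}(x)=\lim_{t\to0}(\mathcal L(\phi_t(x))-\mathcal L(x))/t$ and $\ddot{\mathcal L}=(\dot{\mathcal L})^{\cdot}$. A catenary function for $\Lambda$ is a continuous $\mathcal L\colon N\to\mathbb{R}$, with $N$ an isolating neighborhood of $\Lambda$, such that $\mathcal L(\Lambda)=0$, $\mathcal L(x)>0$ for $x\in N\setminus\Lambda$, and $\ddot{\mathcal L}=\mathcal L$ on $N$. *)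

(* Defs.v *)
From Stdlib Require Import Reals.
Open Scope R_scope.

Section Defs.
Variable M : Metric_Space.
Local Notation X := (Base M).
Local Notation d := (dist M).

Definition open_set (U : X -> Prop) : Prop :=
  forall x, U x -> exists eps, eps > 0 /\ forall y, d x y < eps -> U y.

Definition open_set_RX (G : R -> X -> Prop) : Prop :=
  forall t x, G t x -> exists eps, eps > 0 /\
    forall s y, Rabs (s - t) < eps -> d x y < eps -> G s y.

Definition compact_set (K : X -> Prop) : Prop :=
  forall (I : Type) (U : I -> X -> Prop),
    (forall i, open_set (U i)) ->
    (forall x, K x -> exists i, U i x) ->
    exists l : list I, forall x, K x -> exists i, List.In i l /\ U i x.

(* partial flow phi : Gamma -> X, with Gamma open in R x X; phi is given as a
   total function whose values outside Gamma are irrelevant. *)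
Definition partial_flow (G : R -> X -> Prop) (phi : R -> X -> X) : Prop :=
  open_set_RX G /\
  (forall t x, G t x -> forall eps, eps > 0 -> exists delta, delta > 0 /\
     forall s y, G s y -> Rabs (s - t) < delta -> d x y < delta ->
       d (phi s y) (phi t x) < eps) /\
  (forall x, G 0 x) /\
  (forall x a b c, G a x -> G c x -> a <= b -> b <= c -> G b x) /\
  (forall t x, G t x -> forall s, G s (phi t x) <-> G (s + t) x) /\
  (forall x, phi 0 x = x) /\
  (forall t x s, G t x -> G s (phi t x) -> phi s (phi t x) = phi (s + t) x).

Definition invariant (G : R -> X -> Prop) (phi : R -> X -> X) (L : X -> Prop) :=
  forall x t, L x -> G t x -> L (phi t x).

Definition isolating_nbhd (G : R -> X -> Prop) (phi : R -> X -> X)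
    (Lam N : X -> Prop) : Prop :=
  compact_set N /\
  (exists U, open_set U /\ (forall x, Lam x -> U x) /\ (forall x, U x -> N x)) /\
  (forall x, (forall t, G t x -> N (phi t x)) -> Lam x).

Definition isolated (G : R -> X -> Prop) (phi : R -> X -> X) (Lam : X -> Prop) :=
  invariant G phi Lam /\ exists N, isolating_nbhd G phi Lam N.

(* f : N -> R (total function; values off N irrelevant) has derivative l along
   the flow at x: lim_{t -> 0} (f(phi_t x) - f x)/t = l, the limit being taken
   over those t <> 0 for which f(phi_t x) is defined, i.e. t in Gamma_x and
   phi_t x in N. *)
Definition flow_deriv (G : R -> X -> Prop) (phi : R -> X -> X) (N : X -> Prop)
    (f : X -> R) (x : X) (l : R) : Prop :=
  limit1_in (fun t => (f (phi t x) - f x) / t)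
            (fun t => t <> 0 /\ G t x /\ N (phi t x)) l 0.

Definition continuous_on (N : X -> Prop) (f : X -> R) : Prop :=
  forall x, N x -> forall eps, eps > 0 -> exists delta, delta > 0 /\
    forall y, N y -> d y x < delta -> Rabs (f y - f x) < eps.

Definition catenary_function (G : R -> X -> Prop) (phi : R -> X -> X)
    (Lam N : X -> Prop) (L : X -> R) : Prop :=
  isolating_nbhd G phi Lam N /\
  continuous_on N L /\
  (forall x, Lam x -> L x = 0) /\
  (forall x, N x -> ~ Lam x -> L x > 0) /\
  exists Ld : X -> R,
    (forall x, N x -> flow_deriv G phi N L x (Ld x)) /\
    (forall x, N x -> flow_deriv G phi N Ld x (L x)).

End Defs.

(* Main.v *)
From Stdlib Require Import Reals Lra Classical List.
Require Import Defs.
Open Scope R_scope.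

(** A solution of [L'' = L] along the flow splits into an expanding and a
    contracting part. Let [h : X -> [0,1]] be continuous, equal to [0] near the
    isolated set and to [1] off an isolating neighborhood, and put
    [W x = sup { exp (-t) * h (phi_t x) | t >= 0 }]. As long as the orbit runs
    through [h = 0], [W (phi_t x) = exp t * W x]. Once the orbit meets [h = 1],
    later times contribute less to the supremum, so only a compact piece of the
    orbit matters; this makes [W] continuous although orbits may leave the
    neighborhood, return, or cease to exist. With [W'] the same supremum for the
    reversed flow, [L = W + W'] satisfies [L' = W - W'] and [L'' = L], and
    [L x = 0] forces [h = 0] on the whole orbit of [x]. *)

(** * Suprema in the unit interval *)

Lemma bound_01 (E : R -> Prop) : bound (fun v => v = 0 \/ (E v /\ v <= 1)).
Proof. exists 1. intros v [-> | [_ H]]; lra. Qed.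

Lemma inhabited_01 (E : R -> Prop) : exists v, v = 0 \/ (E v /\ v <= 1).
Proof. exists 0. now left. Qed.

(* [0] is adjoined and values above [1] are discarded, so that the supremum
   exists for every [E]. *)
Definition sup01 (E : R -> Prop) : R :=
  proj1_sig (completeness _ (bound_01 E) (inhabited_01 E)).

Lemma sup01_lub (E : R -> Prop) :
  is_lub (fun v => v = 0 \/ (E v /\ v <= 1)) (sup01 E).
Proof. unfold sup01. now destruct completeness. Qed.

Lemma sup01_ge0 (E : R -> Prop) : 0 <= sup01 E.
Proof. apply (sup01_lub E). now left. Qed.

Lemma sup01_ub (E : R -> Prop) v : E v -> v <= 1 -> v <= sup01 E.
Proof. intros. apply (sup01_lub E). now right. Qed.

Lemma sup01_le (E : R -> Prop) b :
  0 <= b -> (forall v, E v -> v <= b) -> sup01 E <= b.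
Proof.
  intros Hb H. apply (sup01_lub E). intros v [-> | [Hv _]]; auto.
Qed.

(** With [0 <= c] the adjoined [0] cannot be the value above [c], so a genuine element of [E] is
    found. *)
Lemma sup01_gt (E : R -> Prop) c :
  0 <= c -> c < sup01 E -> exists v, E v /\ c < v.
Proof.
  intros Hc H. apply NNPP. intro Hn.
  apply (Rlt_not_le _ _ H), sup01_le; [exact Hc|].
  intros v Hv. apply Rnot_lt_le. intro. apply Hn. now exists v.
Qed.

(** * Compactness *)

(** Finitely many of the balls on which [P] holds with their own radius cover [K]; by monotonicity
    the least of these radii works everywhere. Indexing the cover by all such balls avoids choosing
    a radius for each point. *)
Lemma compact_uniform (M : Metric_Space) (K : Base M -> Prop)
    (P : Base M -> R -> Prop) :
  compact_set M K ->
  (forall y e e', P y e -> 0 < e' <= e -> P y e') ->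
  (forall x, K x -> exists e, e > 0 /\ forall y, dist M x y < e -> P y e) ->
  exists e, e > 0 /\ forall y, K y -> P y e.
Proof.
  intros HK Hmono Hloc.
  set (I := {p : Base M * R |
    snd p > 0 /\ forall y, dist M (fst p) y < snd p -> P y (snd p)}).
  destruct (HK I (fun i y => dist M (fst (proj1_sig i)) y < snd (proj1_sig i)))
    as [l Hl].
  - intros [[x e] Hp]. cbn. intros y Hy. exists (e - dist M x y).
    split; [lra|]. intros z Hz. pose proof (dist_tri M x z y). lra.
  - intros x Hx. destruct (Hloc x Hx) as [e [He Hy]].
    exists (exist _ (x, e) (conj He Hy)). cbn.
    rewrite (proj2 (dist_refl M x x) eq_refl). exact He.
  - assert (Hmin : exists e, e > 0 /\
      forall i : I, In i l -> e <= snd (proj1_sig i)).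
    { clear Hl. induction l as [|i l [e [He Hi]]].
      - exists 1. split; [lra|]. intros i [].
      - exists (Rmin e (snd (proj1_sig i))). split.
        + apply Rmin_pos; [exact He|]. apply (proj2_sig i).
        + intros j [<-|Hj]; [apply Rmin_r|].
          eapply Rle_trans; [apply Rmin_l|auto]. }
    destruct Hmin as [e [He Hi]]. exists e. split; [exact He|].
    intros y Hy. destruct (Hl y Hy) as [i [Hil Hiy]].
    apply Hmono with (snd (proj1_sig i)).
    + now apply (proj2_sig i).
    + split; [exact He|now apply Hi].
Qed.

(** The distance from [x] to the points of [K] is locally bounded below by a positive constant,
    hence uniformly so. *)
Lemma compact_closed (M : Metric_Space) (K : Base M -> Prop) :
  compact_set M K -> open_set M (fun x => ~ K x).
Proof.
  intros HK x Hx.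
  destruct (compact_uniform M K (fun y e => e <= dist M x y) HK) as [e [He H]].
  - intros y e e' H1 H2. lra.
  - intros y Hy. exists (dist M x y / 2).
    assert (dist M x y > 0).
    { destruct (dist_pos M x y) as [H|H]; [exact H|].
      apply dist_refl in H. subst y. contradiction. }
    split; [lra|]. intros z Hz. pose proof (dist_tri M x y z).
    rewrite (dist_sym M z y) in *. lra.
  - exists e. split; [exact He|]. intros y Hy HKy. specialize (H y HKy). lra.
Qed.

(** The complement of [N], indexed by [None], completes a cover of [N] to one of [K]. *)
Lemma closed_subset_compact (M : Metric_Space) (K N : Base M -> Prop) :
  compact_set M K -> open_set M (fun x => ~ N x) -> (forall x, N x -> K x) ->
  compact_set M N.
Proof.
  intros HK Hcl Hsub I U HU Hcov.
  destruct (HK (option I) (fun o x =>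
    match o with Some i => U i x | None => ~ N x end)) as [l Hl].
  - intros [i|]; [apply HU|exact Hcl].
  - intros x _. destruct (classic (N x)) as [Hx|Hx].
    + destruct (Hcov x Hx) as [i Hi]. now exists (Some i).
    + now exists None.
  - exists (flat_map (fun o => match o with Some i => i :: nil | None => nil end) l).
    intros x Hx. destruct (Hl x (Hsub x Hx)) as [[i|] [Hil Hi]].
    + exists i. split; [|exact Hi]. apply in_flat_map.
      exists (Some i). split; [exact Hil|now left].
    + contradiction.
Qed.

(** The analogue of [compact_uniform] for time intervals, obtained from the supremum [c] of all [a]
    such that one [e] serves [[0, a]]. *)
Lemma segment_uniform (P : R -> R -> Prop) (b : R) :
  0 <= b ->
  (forall t e e', P t e -> 0 < e' <= e -> P t e') ->
  (forall t, 0 <= t <= b ->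
     exists e, e > 0 /\ forall t', Rabs (t' - t) < e -> P t' e) ->
  exists e, e > 0 /\ forall t, 0 <= t <= b -> P t e.
Proof.
  intros Hb Hmono Hloc.
  set (S := fun a => 0 <= a <= b /\
    exists e, e > 0 /\ forall t, 0 <= t <= a -> P t e).
  assert (S0 : S 0).
  { split; [lra|]. destruct (Hloc 0) as [e [He H]]; [lra|].
    exists e. split; [exact He|]. intros t Ht. apply H.
    rewrite Rabs_pos_eq; lra. }
  destruct (completeness S) as [c [Hub Hlub]].
  { exists b. intros a [Ha _]. lra. }
  { now exists 0. }
  assert (Hc : 0 <= c <= b).
  { split; [now apply Hub|]. apply Hlub. intros a [Ha _]. lra. }
  destruct (Hloc c Hc) as [e [He H]].
  assert (Ha : exists a, S a /\ c - e < a).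
  { apply NNPP. intro Hn. assert (c <= c - e); [|lra].
    apply Hlub. intros a Ha. apply Rnot_lt_le. intro. apply Hn. now exists a. }
  destruct Ha as [a [[Ha [e' [He' H']]] Hca]].
  (* A uniform radius exists slightly past [c], up to the cap [b]. As [c] bounds [S], the cap must
     be active, so this point is [b]. *)
  assert (Sx : S (Rmin b (c + e / 2))).
  { split.
    - split; [apply Rmin_glb; lra|apply Rmin_l].
    - exists (Rmin e e'). split; [now apply Rmin_pos|].
      pose proof (Rmin_pos e e' He He').
      intros t Ht. pose proof (Rmin_r b (c + e / 2)).
      destruct (Rle_dec t a).
      + apply Hmono with e'; [apply H'; lra|]. split; [lra|apply Rmin_r].
      + apply Hmono with e; [|split; [lra|apply Rmin_l]].
        apply H. apply Rabs_def1; lra. }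
  assert (Hbx : b <= c).
  { pose proof (Hub _ Sx). unfold Rmin in *. destruct (Rle_dec b (c + e / 2)); lra. }
  destruct Sx as [_ [e'' [He'' Hx]]]. exists e''. split; [exact He''|].
  intros t Ht. apply Hx. split; [lra|]. apply Rmin_glb; lra.
Qed.

(** * Bump functions *)

(** The function is [max (0, 1 - dist (x, A) / r)], written as a supremum over [A]; the [0] adjoined
    in [sup01] performs the truncation and covers empty [A]. The Lipschitz bound is one-sided but
    holds for all pairs, hence in both directions. *)
Lemma bump (M : Metric_Space) (A U : Base M -> Prop) (r : R) :
  r > 0 -> (forall y, A y -> forall z, dist M y z < r -> U z) ->
  exists (g : Base M -> R) (k : R), k > 0 /\ (forall x, A x -> g x = 1) /\
    (forall x, ~ U x -> g x = 0) /\ (forall x z, g x <= g z + k * dist M x z).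
Proof.
  intros Hr HU.
  set (g := fun x => sup01 (fun v => exists y, A y /\ v = 1 - / r * dist M x y)).
  assert (Hk : / r > 0) by now apply Rinv_0_lt_compat.
  assert (Hle1 : forall x y, 1 - / r * dist M x y <= 1).
  { intros x y. pose proof (dist_pos M x y).
    assert (0 <= / r * dist M x y); [apply Rmult_le_pos|]; lra. }
  exists g, (/ r). split; [exact Hk|]. split; [|split].
  - intros x Hx. apply Rle_antisym.
    + apply sup01_le; [lra|]. intros v [y [_ ->]]. apply Hle1.
    + apply sup01_ub; [|lra]. exists x. split; [exact Hx|].
      rewrite (proj2 (dist_refl M x x) eq_refl). ring.
  - intros x Hx. apply Rle_antisym; [|apply sup01_ge0].
    apply sup01_le; [lra|]. intros v [y [Hy ->]].
    assert (r <= dist M x y).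
    { apply Rnot_lt_le. intro H. apply Hx, (HU y Hy). now rewrite dist_sym. }
    assert (/ r * r <= / r * dist M x y) by (apply Rmult_le_compat_l; lra).
    rewrite Rinv_l in *; lra.
  - intros x z. apply sup01_le.
    + pose proof (dist_pos M x z). pose proof (sup01_ge0
        (fun v => exists y, A y /\ v = 1 - / r * dist M z y)).
      unfold g. assert (0 <= / r * dist M x z); [apply Rmult_le_pos|]; lra.
    + intros v [y [Hy ->]].
      assert (1 - / r * dist M z y <= g z).
      { apply sup01_ub; [|apply Hle1]. now exists y. }
      assert (/ r * dist M z y <= / r * (dist M x z + dist M x y)).
      { apply Rmult_le_compat_l; [lra|]. rewrite (dist_sym M x z).
        apply dist_tri. }
      lra.
Qed.

(** * Partial flows *)

(** Carries every result on the expanding part over to the contracting part. *)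
Lemma reverse_partial_flow (M : Metric_Space) (G : R -> Base M -> Prop)
    (phi : R -> Base M -> Base M) :
  partial_flow M G phi ->
  partial_flow M (fun t => G (- t)) (fun t => phi (- t)).
Proof.
  intros (Ho & Hc & H0 & Hconv & Hsh & Hid & Hadd).
  assert (Hopp : forall s t, Rabs (- s - - t) = Rabs (s - t)).
  { intros s t. rewrite <- Rabs_Ropp. f_equal. ring. }
  repeat split.
  - intros t x Ht. destruct (Ho _ _ Ht) as [e [He H]]. exists e.
    split; [exact He|]. intros s y Hs Hy. apply H; [now rewrite Hopp|exact Hy].
  - intros t x Ht e He. destruct (Hc _ _ Ht e He) as [d [Hd H]]. exists d.
    split; [exact Hd|]. intros s y Hy Hs Hxy.
    apply H; [exact Hy|now rewrite Hopp|exact Hxy].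
  - intro x. rewrite Ropp_0. apply H0.
  - intros x a b c Ha Hcx Hab Hbc. apply Hconv with (- c) (- a); trivial; lra.
  - intros Hs. rewrite Ropp_plus_distr. now apply Hsh.
  - intros Hs. rewrite Ropp_plus_distr in Hs. now apply Hsh in Hs.
  - intro x. rewrite Ropp_0. apply Hid.
  - intros t x s Ht Hs. rewrite Ropp_plus_distr. now apply Hadd.
Qed.

(** Existence times are bounded below uniformly on a compact set, so an orbit that stays in [K] can
    be prolonged by steps of fixed length until time [b]. *)
Lemma compact_escape (M : Metric_Space) (G : R -> Base M -> Prop)
    (phi : R -> Base M -> Base M) (K : Base M -> Prop) (x : Base M) (b : R) :
  partial_flow M G phi -> compact_set M K -> 0 <= b -> ~ G b x ->
  exists s, 0 <= s <= b /\ G s x /\ ~ K (phi s x).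
Proof.
  intros (Ho & Hc & H0 & Hconv & Hsh & Hid & Hadd) HK Hb Hbx.
  apply NNPP. intro Hn.
  assert (Hin : forall s, 0 <= s <= b -> G s x -> K (phi s x)).
  { intros s Hs Hsx. apply NNPP. intro. apply Hn. now exists s. }
  (* Openness gives existence only for times strictly below [e], hence the half. *)
  destruct (compact_uniform M K (fun y e => G (e / 2) y) HK) as [e [He H]].
  - intros y e e' Hy He. apply Hconv with 0 (e / 2); trivial; lra.
  - intros y _. destruct (Ho 0 y (H0 y)) as [e [He H]]. exists e.
    split; [exact He|]. intros z Hz. apply H; [|exact Hz].
    rewrite Rabs_pos_eq; lra.
  - assert (Hstep : forall n, G (Rmin b (INR n * (e / 2))) x).
    { induction n as [|n IH].
      - cbn. rewrite Rmult_0_l, Rmin_right by exact Hb. apply H0.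
      - set (s := Rmin b (INR n * (e / 2))) in *.
        assert (Hs : 0 <= s <= b).
        { split; [|apply Rmin_l]. apply Rmin_glb; [exact Hb|].
          apply Rmult_le_pos; [apply pos_INR|lra]. }
        pose proof (proj1 (Hsh s x IH _) (H _ (Hin s Hs IH))) as Hse.
        apply Hconv with 0 (e / 2 + s); trivial.
        + apply Rmin_glb; [exact Hb|].
          apply Rmult_le_pos; [apply pos_INR|lra].
        + unfold s. rewrite S_INR. unfold Rmin.
          destruct (Rle_dec b), (Rle_dec b); lra. }
    destruct (INR_unbounded (b / (e / 2))) as [n Hnb].
    apply Hbx. specialize (Hstep n). rewrite Rmin_left in Hstep; [exact Hstep|].
    apply Rlt_le. apply (Rmult_lt_compat_r (e / 2)) in Hnb; [|lra].
    replace (b / (e / 2) * (e / 2)) with b in Hnb by (field; lra). lra.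
Qed.

(** * The expanding part *)

(** Only times at which the forward orbit exists take part. If [0 <= h <= 1], all values lie in the
    unit interval and [sup01] discards none. *)
Definition exit_weight (M : Metric_Space) (G : R -> Base M -> Prop)
    (phi : R -> Base M -> Base M) (h : Base M -> R) (x : Base M) : R :=
  sup01 (fun v => exists t, 0 <= t /\ G t x /\ v = exp (- t) * h (phi t x)).

Lemma exp_opp_le1 t : 0 <= t -> exp (- t) <= 1.
Proof.
  intro Ht. rewrite <- exp_0. destruct (Req_dec t 0) as [->|].
  - rewrite Ropp_0. lra.
  - apply Rlt_le, exp_increasing. lra.
Qed.

Lemma exit_weight_ub (M : Metric_Space) (G : R -> Base M -> Prop)
    (phi : R -> Base M -> Base M) (h : Base M -> R) (x : Base M) (t : R) :
  (forall x, 0 <= h x <= 1) -> 0 <= t -> G t x ->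
  exp (- t) * h (phi t x) <= exit_weight M G phi h x.
Proof.
  intros Hh Ht Hx. apply sup01_ub; [now exists t|].
  specialize (Hh (phi t x)). pose proof (exp_pos (- t)).
  rewrite <- (Rmult_1_r 1). apply Rmult_le_compat; try lra.
  now apply exp_opp_le1.
Qed.

Lemma exit_weight_eq0 (M : Metric_Space) (G : R -> Base M -> Prop)
    (phi : R -> Base M -> Base M) (h : Base M -> R) (x : Base M) :
  (forall x, 0 <= h x <= 1) ->
  exit_weight M G phi h x = 0 <->
  (forall t, 0 <= t -> G t x -> h (phi t x) = 0).
Proof.
  intros Hh. split.
  - intros HW t Ht Hx. pose proof (exit_weight_ub M G phi h x t Hh Ht Hx) as H.
    rewrite HW in H. pose proof (exp_pos (- t)). specialize (Hh (phi t x)).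
    apply Rle_antisym; [|apply Hh].
    apply Rmult_le_reg_l with (exp (- t)); lra.
  - intro H. apply Rle_antisym; [|apply sup01_ge0].
    apply sup01_le; [lra|]. intros v [t [Ht [Hx ->]]]. rewrite H; trivial. lra.
Qed.

(** The values collected from [phi t x] are those collected from [x] at times at least [t],
    multiplied by [exp t]; the earlier times contribute [0]. *)
Lemma exit_weight_forward (M : Metric_Space) (G : R -> Base M -> Prop)
    (phi : R -> Base M -> Base M) (h : Base M -> R) (x : Base M) (t : R) :
  partial_flow M G phi -> (forall x, 0 <= h x <= 1) -> 0 <= t -> G t x ->
  (forall s, 0 <= s <= t -> h (phi s x) = 0) ->
  exit_weight M G phi h (phi t x) = exp t * exit_weight M G phi h x.
Proof.
  intros (Ho & Hc & H0 & Hconv & Hsh & Hid & Hadd) Hh Ht Hx Hz.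
  pose proof (exp_pos t) as Ep.
  assert (Hinv : exp t * exp (- t) = 1).
  { rewrite <- exp_plus, Rplus_opp_r. apply exp_0. }
  apply Rle_antisym.
  - apply sup01_le.
    + apply Rmult_le_pos; [lra|apply sup01_ge0].
    + intros v [a [Ha [Hax ->]]]. rewrite Hadd by assumption.
      replace (exp (- a)) with (exp t * exp (- (a + t))).
      2:{ rewrite <- exp_plus. f_equal. ring. }
      rewrite Rmult_assoc. apply Rmult_le_compat_l; [lra|].
      apply exit_weight_ub; [exact Hh|lra|now apply Hsh].
  - assert (H : exit_weight M G phi h x
      <= exp (- t) * exit_weight M G phi h (phi t x)).
    { pose proof (exp_pos (- t)). apply sup01_le.
      - apply Rmult_le_pos; [lra|apply sup01_ge0].
      - intros v [a [Ha [Hax ->]]]. destruct (Rle_dec a t) as [Hat|Hat].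
        + rewrite (Hz a) by lra. rewrite Rmult_0_r.
          apply Rmult_le_pos; [lra|apply sup01_ge0].
        + replace (exp (- a)) with (exp (- t) * exp (- (a - t))).
          2:{ rewrite <- exp_plus. f_equal. ring. }
          assert (Hg : G (a - t) (phi t x)).
          { apply Hsh; [exact Hx|]. now replace (a - t + t) with a by ring. }
          replace (phi a x) with (phi (a - t) (phi t x)).
          2:{ rewrite Hadd by assumption. f_equal. ring. }
          rewrite Rmult_assoc. apply Rmult_le_compat_l; [lra|].
          apply exit_weight_ub; [exact Hh|lra|exact Hg]. }
    apply (Rmult_le_compat_l (exp t)) in H; [|lra].
    rewrite <- Rmult_assoc, Hinv in H. lra.
Qed.

(** For negative [t] the forward case is applied at [phi t x], whose orbit returns to [x] after time
    [- t]. *)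
Lemma exit_weight_flow (M : Metric_Space) (G : R -> Base M -> Prop)
    (phi : R -> Base M -> Base M) (h : Base M -> R) (x : Base M) (t : R) :
  partial_flow M G phi -> (forall x, 0 <= h x <= 1) -> G t x ->
  (forall s, Rabs s <= Rabs t -> G s x -> h (phi s x) = 0) ->
  exit_weight M G phi h (phi t x) = exp t * exit_weight M G phi h x.
Proof.
  intros Hpf Hh Hx Hz.
  pose proof Hpf as (Ho & Hc & H0 & Hconv & Hsh & Hid & Hadd).
  destruct (Rle_dec 0 t) as [Ht|Ht].
  - apply exit_weight_forward; trivial. intros s Hs. apply Hz.
    + rewrite !Rabs_pos_eq; lra.
    + apply Hconv with 0 t; trivial; lra.
  - assert (Hback : G (- t) (phi t x)).
    { apply Hsh; [exact Hx|]. rewrite Rplus_opp_l. apply H0. }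
    assert (Hret : phi (- t) (phi t x) = x).
    { rewrite Hadd by assumption. now rewrite Rplus_opp_l. }
    pose proof (exit_weight_forward M G phi h (phi t x) (- t) Hpf Hh) as H.
    rewrite Hret in H. rewrite H; trivial; try lra.
    + rewrite <- Rmult_assoc, <- exp_plus, Rplus_opp_r, exp_0. ring.
    + intros s Hs.
      assert (G (s + t) x) by (apply Hconv with t 0; trivial; lra).
      rewrite Hadd; trivial; [|now apply Hsh].
      apply Hz; [|assumption]. rewrite !Rabs_left1; lra.
Qed.

(** * Continuity of the expanding part *)

Lemma lipschitz_flow_continuous (M : Metric_Space) (G : R -> Base M -> Prop)
    (phi : R -> Base M -> Base M) (h : Base M -> R) (k : R) (t : R) (x : Base M) :
  partial_flow M G phi -> (forall x, 0 <= h x <= 1) -> k > 0 ->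
  (forall x z, h x <= h z + k * dist M x z) -> G t x ->
  forall eps, eps > 0 -> exists delta, delta > 0 /\
    forall s y, G s y -> Rabs (s - t) < delta -> dist M x y < delta ->
      Rabs (exp (- s) * h (phi s y) - exp (- t) * h (phi t x)) < eps.
Proof.
  intros (_ & Hc & _) Hh Hk Hl Hx eps He.
  set (c := exp (- t)). assert (Hcp : 0 < c) by apply exp_pos.
  assert (Hck : 0 < c * k) by (apply Rmult_lt_0_compat; lra).
  (* After multiplication by the Lipschitz constant [k] and the factor [c], the change of [h] stays
     below [eps / 2]. *)
  destruct (Hc t x Hx (eps / 2 / (c * k))) as [d1 [Hd1 H1]].
  { apply Rdiv_lt_0_compat; lra. }
  assert (Hcont : continuity_pt (fun s => exp (- s)) t) by reg.
  destruct (Hcont (eps / 2)) as [d2 [Hd2 H2]]; [lra|].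
  cbn in H2. unfold Rdist in H2.
  exists (Rmin d1 d2). split; [now apply Rmin_pos|]. intros s y Hg Hs Hy.
  pose proof (Rmin_l d1 d2). pose proof (Rmin_r d1 d2).
  specialize (H1 s y Hg ltac:(lra) ltac:(lra)).
  assert (E1 : Rabs (exp (- s) - c) < eps / 2).
  (* [continuity_pt] speaks only of points other than [t]. *)
  { destruct (Req_dec s t) as [->|Hst].
    - unfold c, Rminus. rewrite Rplus_opp_r, Rabs_R0. lra.
    - apply H2. repeat split; [congruence|lra]. }
  assert (E2 : Rabs (h (phi s y) - h (phi t x)) <= k * dist M (phi s y) (phi t x)).
  { pose proof (Hl (phi s y) (phi t x)) as Ha.
    pose proof (Hl (phi t x) (phi s y)) as Hb.
    rewrite (dist_sym M (phi t x)) in Hb. apply Rabs_le. lra. }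
  assert (E3 : c * Rabs (h (phi s y) - h (phi t x)) < eps / 2).
  { apply Rle_lt_trans with (c * k * dist M (phi s y) (phi t x)).
    - rewrite Rmult_assoc. apply Rmult_le_compat_l; lra.
    - apply (Rmult_lt_compat_l (c * k)) in H1; [|exact Hck].
      replace (c * k * (eps / 2 / (c * k))) with (eps / 2) in H1 by (field; lra).
      exact H1. }
  replace (exp (- s) * h (phi s y) - c * h (phi t x)) with
    ((exp (- s) - c) * h (phi s y) + c * (h (phi s y) - h (phi t x))) by ring.
  eapply Rle_lt_trans; [apply Rabs_triang|]. rewrite !Rabs_mult.
  rewrite (Rabs_pos_eq c), (Rabs_pos_eq (h (phi s y))) by (try lra; apply Hh).
  assert (Rabs (exp (- s) - c) * h (phi s y) <= Rabs (exp (- s) - c) * 1).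
  { apply Rmult_le_compat_l; [apply Rabs_pos|apply Hh]. }
  lra.
Qed.

(** A time that nearly attains the supremum at [x] is still available, with nearly the same value,
    at all close [y], since the domain of the flow is open. *)
Lemma exit_weight_lower (M : Metric_Space) (G : R -> Base M -> Prop)
    (phi : R -> Base M -> Base M) (h : Base M -> R) (k : R) (x : Base M) :
  partial_flow M G phi -> (forall x, 0 <= h x <= 1) -> k > 0 ->
  (forall x z, h x <= h z + k * dist M x z) ->
  forall eps, eps > 0 -> exists delta, delta > 0 /\
    forall y, dist M x y < delta ->
      exit_weight M G phi h x - eps < exit_weight M G phi h y.
Proof.
  intros Hpf Hh Hk Hl eps He.
  (* Below [0] there need not be such a time, but then nonnegativity of the weight suffices. *)
  destruct (Rlt_le_dec (exit_weight M G phi h x - eps / 2) 0) as [Hneg|Hpos].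
  { exists 1. split; [lra|]. intros y _.
    assert (0 <= exit_weight M G phi h y) by apply sup01_ge0. lra. }
  assert (Hlt : exit_weight M G phi h x - eps / 2 < exit_weight M G phi h x) by lra.
  apply (sup01_gt _ _ Hpos) in Hlt. destruct Hlt as [v [[t [Ht [Hx ->]]] Hv]].
  destruct (lipschitz_flow_continuous M G phi h k t x Hpf Hh Hk Hl Hx (eps / 2))
    as [d [Hd H]]; [lra|].
  destruct (proj1 Hpf t x Hx) as [e [He' Hopen]].
  exists (Rmin d e). split; [now apply Rmin_pos|]. intros y Hy.
  pose proof (Rmin_l d e). pose proof (Rmin_r d e).
  assert (R0 : Rabs (t - t) = 0) by (unfold Rminus; rewrite Rplus_opp_r; apply Rabs_R0).
  assert (Hgy : G t y) by (apply Hopen; lra).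
  assert (Hq := H t y Hgy ltac:(lra) ltac:(lra)). apply Rabs_def2 in Hq.
  pose proof (exit_weight_ub M G phi h y t Hh Ht Hgy). lra.
Qed.

(** From some time [b] on, the factor [exp (- t)] alone is below the required bound, whatever the
    orbit of [y] does. On [[0, b]], where the orbit of [x] exists, continuity is made uniform in
    time. *)
Lemma exit_weight_upper (M : Metric_Space) (G : R -> Base M -> Prop)
    (phi : R -> Base M -> Base M) (K : Base M -> Prop) (h : Base M -> R)
    (k : R) (x : Base M) :
  partial_flow M G phi -> compact_set M K -> (forall x, 0 <= h x <= 1) -> k > 0 ->
  (forall x z, h x <= h z + k * dist M x z) -> (forall x, ~ K x -> h x = 1) ->
  forall eps, eps > 0 -> exists delta, delta > 0 /\
    forall y, dist M x y < delta ->
      exit_weight M G phi h y <= exit_weight M G phi h x + eps.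
Proof.
  intros Hpf HK Hh Hk Hl H1 eps He.
  pose proof Hpf as (Ho & Hc & H0 & Hconv & _).
  assert (HW : 0 <= exit_weight M G phi h x) by apply sup01_ge0.
  assert (Hs : exists s, 0 <= s /\ G s x /\
    forall t, s <= t -> exp (- t) <= exit_weight M G phi h x + eps).
  { assert (Hmon : forall s t, s <= t -> exp (- t) <= exp (- s)).
    { intros s t [Hst|<-]; [|lra]. apply Rlt_le, exp_increasing. lra. }
    assert (Hinv : / eps > 0) by now apply Rinv_0_lt_compat.
    (* Either the orbit lasts until [/ eps], where [exp (- / eps) <= eps] because [exp u >= u]; or
       it leaves [K] at some earlier [s], where [h = 1] makes the weight of [x] at least
       [exp (- s)]. *)
    destruct (classic (G (/ eps) x)) as [Hg|Hg].
    - exists (/ eps). split; [lra|]. split; [exact Hg|]. intros t Ht.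
      apply Rle_trans with (exp (- / eps)); [now apply Hmon|].
      assert (exp (- / eps) <= eps); [|lra].
      rewrite exp_Ropp. replace eps with (/ / eps) at 2 by apply Rinv_inv.
      apply Rinv_le_contravar; [lra|].
      pose proof (exp_ineq1_le (/ eps)). lra.
    - destruct (compact_escape M G phi K x (/ eps) Hpf HK) as [s [Hs [Hg' Hn]]];
        [lra|exact Hg|].
      exists s. split; [lra|]. split; [exact Hg'|]. intros t Ht.
      pose proof (exit_weight_ub M G phi h x s Hh (proj1 Hs) Hg') as Hub.
      rewrite (H1 _ Hn) in Hub. specialize (Hmon s t Ht). lra. }
  destruct Hs as [b [Hb [Hbx Hlate]]].
  destruct (segment_uniform (fun t e => forall y, dist M x y < e -> G t y ->
    exp (- t) * h (phi t y) <= exit_weight M G phi h x + eps) b Hb)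
    as [d [Hd H]].
  - intros t e e' He' Hle y Hy. apply He'. lra.
  - intros t Ht. assert (Hgt : G t x) by (apply Hconv with 0 b; trivial; lra).
    destruct (lipschitz_flow_continuous M G phi h k t x Hpf Hh Hk Hl Hgt eps He)
      as [d [Hd H]].
    exists d. split; [exact Hd|]. intros t' Ht' y Hy Hg.
    specialize (H t' y Hg Ht' Hy). apply Rabs_def2 in H.
    pose proof (exit_weight_ub M G phi h x t Hh (proj1 Ht) Hgt). lra.
  - exists d. split; [exact Hd|]. intros y Hy. apply sup01_le; [lra|].
    intros v [t [Ht [Hg ->]]]. destruct (Rle_dec t b) as [Htb|Htb].
    + apply (H t); trivial. lra.
    + apply Rle_trans with (exp (- t)); [|apply Hlate; lra].
      specialize (Hh (phi t y)). pose proof (exp_pos (- t)).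
      rewrite <- (Rmult_1_r (exp (- t))) at 2. apply Rmult_le_compat_l; lra.
Qed.

Lemma exit_weight_continuous (M : Metric_Space) (G : R -> Base M -> Prop)
    (phi : R -> Base M -> Base M) (K : Base M -> Prop) (h : Base M -> R)
    (k : R) (x : Base M) :
  partial_flow M G phi -> compact_set M K -> (forall x, 0 <= h x <= 1) -> k > 0 ->
  (forall x z, h x <= h z + k * dist M x z) -> (forall x, ~ K x -> h x = 1) ->
  forall eps, eps > 0 -> exists delta, delta > 0 /\
    forall y, dist M x y < delta ->
      Rabs (exit_weight M G phi h y - exit_weight M G phi h x) < eps.
Proof.
  intros Hpf HK Hh Hk Hl H1 eps He.
  destruct (exit_weight_lower M G phi h k x Hpf Hh Hk Hl eps He) as [d [Hd H]].
  destruct (exit_weight_upper M G phi K h k x Hpf HK Hh Hk Hl H1 (eps / 2))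
    as [d' [Hd' H']]; [lra|].
  exists (Rmin d d'). split; [now apply Rmin_pos|]. intros y Hy.
  pose proof (Rmin_l d d'). pose proof (Rmin_r d d').
  specialize (H y ltac:(lra)). specialize (H' y ltac:(lra)).
  apply Rabs_def1; lra.
Qed.

(** * Catenary functions *)

(** Reduces to the ordinary derivative at time [0], since [flow_deriv] only restricts the admissible
    times. The sign of [b] is free, so the lemma serves for both derivatives. *)
Lemma flow_deriv_exp (M : Metric_Space) (G : R -> Base M -> Prop)
    (phi : R -> Base M -> Base M) (N : Base M -> Prop) (f : Base M -> R)
    (x : Base M) (a b delta : R) :
  delta > 0 -> f x = a + b ->
  (forall t, Rabs t < delta -> G t x -> f (phi t x) = a * exp t + b * exp (- t)) ->
  flow_deriv M G phi N f x (a - b).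
Proof.
  intros Hd Hx Hf.
  assert (D : derivable_pt_lim (fun t => a * exp t + b * exp (- t)) 0 (a - b)).
  { replace (a - b) with (a * exp 0 + b * (exp (- 0) * - 1)).
    2:{ rewrite Ropp_0, exp_0. ring. }
    apply derivable_pt_lim_plus.
    - apply derivable_pt_lim_scal, derivable_pt_lim_exp.
    - apply derivable_pt_lim_scal.
      apply (derivable_pt_lim_comp (fun t => - t) exp).
      + apply (derivable_pt_lim_opp (fun t => t)), derivable_pt_lim_id.
      + apply derivable_pt_lim_exp. }
  intros eps He. destruct (D eps He) as [[d' Hd'] H]. cbn in H.
  exists (Rmin delta d'). split; [now apply Rmin_pos|].
  intros t [[Ht [Hg _]] Hdist]. cbn in Hdist |- *. unfold Rdist in *.
  rewrite Rminus_0_r in Hdist.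
  pose proof (Rmin_l delta d'). pose proof (Rmin_r delta d').
  specialize (H t Ht ltac:(lra)). rewrite Rplus_0_l, Ropp_0, exp_0 in H.
  rewrite Hf, Hx by (trivial; lra).
  now replace (a + b) with (a * 1 + b * 1) by ring.
Qed.

(** The orbit of a point off [Lam] is outside [K] at some time [t]. Nearby points are outside [K] at
    the same [t], whereas invariance keeps points of [Lam] inside. *)
Lemma isolated_closed (M : Metric_Space) (G : R -> Base M -> Prop)
    (phi : R -> Base M -> Base M) (Lam K : Base M -> Prop) :
  partial_flow M G phi -> invariant M G phi Lam ->
  isolating_nbhd M G phi Lam K -> open_set M (fun x => ~ Lam x).
Proof.
  intros (Ho & Hc & _) Hinv (HK & (U & _ & HLU & HUK) & Hiso) x Hx.
  assert (Ht : exists t, G t x /\ ~ K (phi t x)).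
  { apply NNPP. intro Hn. apply Hx, Hiso. intros t Ht. apply NNPP. intro.
    apply Hn. now exists t. }
  destruct Ht as [t [Ht HKt]].
  destruct (compact_closed M K HK _ HKt) as [e [He Hout]].
  destruct (Ho t x Ht) as [d1 [Hd1 H1]].
  destruct (Hc t x Ht e He) as [d2 [Hd2 H2]].
  assert (R0 : Rabs (t - t) = 0) by (unfold Rminus; rewrite Rplus_opp_r; apply Rabs_R0).
  exists (Rmin d1 d2). split; [now apply Rmin_pos|]. intros y Hy HL.
  pose proof (Rmin_l d1 d2). pose proof (Rmin_r d1 d2).
  assert (Hg : G t y) by (apply H1; lra).
  apply (Hout (phi t y)).
  - rewrite dist_sym. apply H2; trivial; lra.
  - now apply HUK, HLU, Hinv.
Qed.

(** Uniformity is taken over [K], with a condition that is void off [Lam]; closedness of [Lam]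
    provides the local radius at the points outside it. *)
Lemma isolated_collar (M : Metric_Space) (G : R -> Base M -> Prop)
    (phi : R -> Base M -> Base M) (Lam K U : Base M -> Prop) :
  partial_flow M G phi -> invariant M G phi Lam ->
  isolating_nbhd M G phi Lam K -> open_set M U -> (forall x, Lam x -> U x) ->
  exists r, r > 0 /\ forall y, Lam y -> forall z, dist M y z < r -> U z.
Proof.
  intros Hpf Hinv Hiso HU HLU.
  pose proof (isolated_closed M G phi Lam K Hpf Hinv Hiso) as Hcl.
  destruct Hiso as (HK & (V & _ & HLV & HVK) & _).
  destruct (compact_uniform M K
    (fun y r => Lam y -> forall z, dist M y z < r -> U z) HK) as [r [Hr H]].
  - intros y e e' H He HL z Hz. apply H; trivial. lra.
  - intros x _. destruct (classic (Lam x)) as [Hx|Hx].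
    + destruct (HU x (HLU x Hx)) as [e [He H]]. exists (e / 2).
      split; [lra|]. intros y Hy _ z Hz. apply H.
      pose proof (dist_tri M x z y). lra.
    + destruct (Hcl x Hx) as [e [He H]]. exists e. split; [exact He|].
      intros y Hy HL. now destruct (H y Hy).
  - exists r. split; [exact Hr|]. intros y Hy. apply H; auto.
Qed.

Theorem mainTheorem9 (M : Metric_Space) (G : R -> Base M -> Prop)
  (phi : R -> Base M -> Base M) (Lam : Base M -> Prop) :
  partial_flow M G phi ->
  isolated M G phi Lam ->
  exists (N : Base M -> Prop) (L : Base M -> R), catenary_function M G phi Lam N L.
Proof.
  intros Hpf [Hinv [K HisoK]].
  pose proof HisoK as (HK & (U & HU & HLU & HUK) & Hiso).
  destruct (isolated_collar M G phi Lam K U Hpf Hinv HisoK HU HLU) as [r [Hr HrU]].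
  destruct (bump M Lam U r Hr HrU) as [g [k [Hk [Hg1 [Hg0 Hlip]]]]].
  (* This is [0] where [g >= 1 / 2] and [1] where [g = 0], in particular off [K]. With [N] given by
     [g >= 3 / 4], a margin of [1 / 4] remains around [N]. *)
  set (h := fun x => Rmax 0 (Rmin 1 (1 - 2 * g x))).
  assert (Hh : forall x, 0 <= h x <= 1).
  { intro x. unfold h, Rmax, Rmin. repeat destruct Rle_dec; lra. }
  assert (Hhl : forall x z, h x <= h z + (2 * k) * dist M x z).
  { intros x z. pose proof (Hlip z x) as H. rewrite (dist_sym M z x) in H.
    assert (0 <= k * dist M x z).
    { apply Rmult_le_pos; [lra|]. apply Rge_le, dist_pos. }
    unfold h, Rmax, Rmin. repeat destruct Rle_dec; lra. }
  assert (Hh0 : forall x, 1 / 2 <= g x -> h x = 0).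
  { intros x Hx. unfold h, Rmax, Rmin. repeat destruct Rle_dec; lra. }
  assert (Hh1 : forall x, ~ K x -> h x = 1).
  { intros x Hx. unfold h. rewrite (Hg0 x) by auto.
    unfold Rmax, Rmin. repeat destruct Rle_dec; lra. }
  assert (HNK : forall x, 3 / 4 <= g x -> K x).
  { intros x Hx. apply NNPP. intro H. rewrite (Hg0 x) in Hx by auto. lra. }
  pose proof (reverse_partial_flow M G phi Hpf) as Hpr.
  set (W := exit_weight M G phi h).
  set (W' := exit_weight M (fun t => G (- t)) (fun t => phi (- t)) h).
  assert (Hk2 : 2 * k > 0) by lra.
  assert (HW : forall x, 0 <= W x) by (intro; apply sup01_ge0).
  assert (HW' : forall x, 0 <= W' x) by (intro; apply sup01_ge0).
  (* [h] vanishes on a neighborhood of [N], not just on [N]: an orbit may meet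
     [N] at arbitrarily small times without staying in [N] in between. *)
  assert (Hloc : forall x, 3 / 4 <= g x -> exists d, d > 0 /\
    forall t, Rabs t < d -> G t x ->
      W (phi t x) = exp t * W x /\ W' (phi t x) = exp (- t) * W' x).
  { intros x Hx. pose proof Hpf as (Ho & Hc & H0 & _ & _ & Hid & _).
    (* Within this distance [g] drops by at most [1 / 4], from [3 / 4] to no less than [1 / 2]. *)
    destruct (Hc 0 x (H0 x) (/ (4 * k))) as [d [Hd H]].
    { apply Rinv_0_lt_compat. lra. }
    assert (Hz : forall s, Rabs s < d -> G s x -> h (phi s x) = 0).
    { intros s Hs Hgs. apply Hh0.
      assert (Hn : dist M (phi s x) (phi 0 x) < / (4 * k)).
      { apply H; trivial; [now rewrite Rminus_0_r|].
        now rewrite (proj2 (dist_refl M x x) eq_refl). }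
      rewrite Hid in Hn. pose proof (Hlip x (phi s x)) as Hb.
      rewrite dist_sym in Hn.
      apply (Rmult_lt_compat_l k) in Hn; [|exact Hk].
      replace (k * / (4 * k)) with (1 / 4) in Hn by (field; lra). lra. }
    exists d. split; [exact Hd|]. intros t Ht Hgt. split.
    - apply exit_weight_flow; trivial. intros s Hs. apply Hz. lra.
    (* Time [- t] of the reversed flow is time [t] of the flow, whence the factor [exp (- t)]. *)
    - pose proof (exit_weight_flow M _ _ h x (- t) Hpr Hh) as E. cbn in E.
      rewrite Ropp_involutive in E. apply E; trivial.
      intros s Hs. rewrite Rabs_Ropp in Hs. apply Hz. rewrite Rabs_Ropp. lra. }
  exists (fun x => 3 / 4 <= g x), (fun x => W x + W' x).
  split; [|split; [|split; [|split]]].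
  - split; [|split].
    + apply closed_subset_compact with K; trivial.
      intros x Hx. apply Rnot_le_lt in Hx. exists ((3 / 4 - g x) / k).
      split; [apply Rdiv_lt_0_compat; lra|]. intros y Hy Hgy.
      pose proof (Hlip y x) as H. rewrite (dist_sym M y x) in H.
      apply (Rmult_lt_compat_l k) in Hy; [|exact Hk].
      replace (k * ((3 / 4 - g x) / k)) with (3 / 4 - g x) in Hy by (field; lra).
      lra.
    + exists (fun x => 3 / 4 < g x). split; [|split].
      * intros x Hx. exists ((g x - 3 / 4) / k).
        split; [apply Rdiv_lt_0_compat; lra|]. intros y Hy.
        pose proof (Hlip x y) as H.
        apply (Rmult_lt_compat_l k) in Hy; [|exact Hk].
        replace (k * ((g x - 3 / 4) / k)) with (g x - 3 / 4) in Hy by (field; lra).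
        lra.
      * intros x Hx. rewrite (Hg1 x Hx). lra.
      * intros x Hx. lra.
    + intros x Hx. apply Hiso. auto.
  - intros x _ eps He.
    destruct (exit_weight_continuous M G phi K h (2 * k) x Hpf HK Hh Hk2 Hhl Hh1
      (eps / 2)) as [d [Hd H]]; [lra|].
    destruct (exit_weight_continuous M _ _ K h (2 * k) x Hpr HK Hh Hk2 Hhl Hh1
      (eps / 2)) as [d' [Hd' H']]; [lra|].
    exists (Rmin d d'). split; [now apply Rmin_pos|]. intros y _ Hy.
    pose proof (Rmin_l d d'). pose proof (Rmin_r d d').
    rewrite dist_sym in Hy.
    specialize (H y ltac:(lra)). specialize (H' y ltac:(lra)).
    fold W in H. fold W' in H'. apply Rabs_def2 in H, H'. apply Rabs_def1; lra.
  - intros x Hx.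
    assert (Horb : forall t, G t x -> h (phi t x) = 0).
    { intros t Ht. apply Hh0. rewrite (Hg1 _ (Hinv x t Hx Ht)). lra. }
    assert (E : W x = 0) by (apply exit_weight_eq0; auto).
    assert (E' : W' x = 0) by (apply exit_weight_eq0; auto).
    rewrite E, E'. ring.
  - intros x _ Hx. specialize (HW x). specialize (HW' x).
    destruct (Rtotal_order (W x + W' x) 0) as [H|[H|H]]; [lra| |exact H].
    (* If both nonnegative parts vanish, [h = 0] along the whole orbit; as [h = 1] off [K], the
       orbit stays in [K] and [x] lies in [Lam]. *)
    exfalso. apply Hx, Hiso. intros t Ht.
    assert (h (phi t x) = 0).
    { destruct (Rle_dec 0 t).
      - apply (proj1 (exit_weight_eq0 M G phi h x Hh)); trivial. fold W. lra.
      - rewrite <- (Ropp_involutive t) in Ht |- *.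
        apply (proj1 (exit_weight_eq0 M (fun t => G (- t)) (fun t => phi (- t)) h x Hh));
          [fold W'; lra|lra|exact Ht]. }
    apply NNPP. intro HnK. rewrite (Hh1 _ HnK) in *. lra.
  - exists (fun x => W x - W' x). split; intros x Hx;
      destruct (Hloc x Hx) as [d [Hd H]].
    + apply flow_deriv_exp with d; trivial. intros t Ht Hg.
      destruct (H t Ht Hg) as [-> ->]. ring.
    (* The coefficients of [W - W'] are [W x] and [- W' x]. *)
    + replace (W x + W' x) with (W x - - W' x) by ring.
      apply flow_deriv_exp with d; trivial. intros t Ht Hg.
      destruct (H t Ht Hg) as [-> ->]. ring.
Qed.
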